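(* Let $B$ be a Banach SSD space (Simons space) and $A\subseteq B$ a maximally $q$-positive set. Define $E^A,E_A:\mathbb{R}_+\rightrightarrows B$ by $E^A(\varepsilon)=\{b\in B:q(b-c)\geq-\varepsilon\text{ for all }c\in A\}$ and $E_A(\varepsilon)=\bigcap_{E\in\mathbb{E}(A)}E(\varepsilon)$ for all $\varepsilon\geq 0$. Then: (i) If $E\in\mathbb{E}(A)$ then $\overline{E}\in\mathbb{E}_c(A)$. (ii) If $E\in\mathbb{E}_c(A)$ then $E(\varepsilon)$ is closed for all $\varepsilon\geq 0$. (iii) $\overline{E_A}$ and $E^A$ are, respectively, the smallest and the biggest elements in $\mathbb{E}_c(A)$ with respect to the partial ordering given by inclusion of graphs, that is, $G(\overline{E_A})\subseteq G(E)\subseteq G(E^A)$ for all $E\in\mathbb{E}_c(A)$.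
   Context: A symmetrically self-dual space (SSD space) is a pair $(B,\lfloor\cdot,\cdot\rfloor)$ where $B$ is a nonzero real vector space and $\lfloor\cdot,\cdot\rfloor:B\times B\to\mathbb{R}$ is a symmetric bilinear form. Put $q:B\to\mathbb{R}$, $q(b)=\frac12\lfloor b,b\rfloor$. $B$ is a Banach SSD space (Simons space) if it is an SSD space with a norm $\|\cdot\|$ making it a Banach space with norm-dual $B^*$, such that $\frac12\|\cdot\|^2+q\geq 0$ on $B$ and there exists a linear continuous map $\iota:B\to B^*$ with $\langle b,\iota(c)\rangle=\lfloor b,c\rfloor$ for all $b,c\in B$. A set $A\subseteq B$ is $q$-positive if $A\neq\emptyset$ and $q(b-c)\geq 0$ for all $b,c\in A$; it is maximally $q$-positive if it is $q$-positive and maximal with respect to inclusion among the $q$-positive subsets of $B$. $\mathbb{R}_+=[0,+\infty)$. The graph of $E:\mathbb{R}_+\rightrightarrows B$ is $G(E)=\{(\varepsilon,b)\in\mathbb{R}_+\times B: b\in E(\varepsilon)\}$. A multifunction $E:\mathbb{R}_+\rightrightarrows B$ satisfies the transportation formula if for all $\varepsilon_1,\varepsilon_2\geq 0$, $b^1\in E(\varepsilon_1)$, $b^2\in E(\varepsilon_2)$ and all $\alpha_1,\alpha_2\geq 0$ with $\alpha_1+\alpha_2=1$ one has $\varepsilon:=\alpha_1\varepsilon_1+\alpha_2\varepsilon_2+\alpha_1\alpha_2 q(b^1-b^2)\geq 0$ and $\alpha_1b^1+\alpha_2b^2\in E(\varepsilon)$. $\mathbb{E}(A)$ is the family of multifunctions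 $E:\mathbb{R}_+\rightrightarrows B$ such that: (r1) $E$ is an enlargement of $A$, i.e. $A\subseteq E(\varepsilon)$ for all $\varepsilon\geq 0$; (r2) $E$ is nondecreasing, i.e. $0\leq\varepsilon_1\leq\varepsilon_2$ implies $E(\varepsilon_1)\subseteq E(\varepsilon_2)$; (r3) $E$ satisfies the transportation formula. For $E:\mathbb{R}_+\rightrightarrows B$, $\overline{E}:\mathbb{R}_+\rightrightarrows B$ is defined by $\overline{E}(\varepsilon)=\{b\in B:(\varepsilon,b)\in\overline{G(E)}\}$, the closure being taken in the norm topology; $E$ is closed if $E=\overline{E}$ (equivalently, $G(E)$ is closed). $\mathbb{E}_c(A)=\{E\in\mathbb{E}(A):E\text{ is closed}\}$. *)

(* Defs.v *)
From HB Require Import structures.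
From mathcomp Require Import all_boot all_order all_algebra.
From mathcomp Require Import all_classical all_reals all_analysis.
Import Order.TTheory GRing.Theory Num.Theory.
Import numFieldNormedType.Exports.

Set Implicit Arguments.
Unset Strict Implicit.
Unset Printing Implicit Defensive.

Local Open Scope classical_set_scope.
Local Open Scope ring_scope.

Section Dual.
Context {R : realType} (V : normedModType R).

(* R^o rather than R, so that functionals live in the canonical lmodType of
   functions. *)
Definition dual_pred : {pred V -> R^o} :=
  mem [set f : V -> R^o | linear f /\ continuous f].

Lemma dual_pred_submod_closed : submod_closed dual_pred.
Proof.
split=> [|a f g]; rewrite !inE /=.
  split=> [k u v|]; first by rewrite /= scaler0 addr0.
  by move=> x; exact: cvg_cst.
move=> [lf cf] [lg cg]; split=> [k u v|x].
  have E w : (a *: f + g) w = a *: f w + g w by [].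
  by rewrite !E lf lg !scalerDr !scalerA [a * k]mulrC addrACA.
by apply: cvgD; [apply: cvgZr; exact: cf|exact: cg].
Qed.

HB.instance Definition _ :=
  GRing.isSubmodClosed.Build R (V -> R^o) dual_pred dual_pred_submod_closed.

Record dual : Type := Dual {
  dual_fun :> V -> R^o;
  dual_funP : dual_fun \in dual_pred }.

HB.instance Definition _ := [isSub for dual_fun].
HB.instance Definition _ := [Choice of dual by <:].
HB.instance Definition _ := [SubChoice_isSubLmodule of dual by <:].

Definition dual_norm (f : dual) : R := sup [set `|f x| | x in [set x | `|x| <= 1]].

Let has_supB (f : dual) : has_sup [set `|f x| | x in [set x | `|x| <= 1]].
Proof.
split; first by exists `|f 0|; exists 0 => //=; rewrite normr0.
have /set_mem[lf cf] := dual_funP f.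
pose lF := GRing.isLinear.Build _ _ _ _ (f : V -> R^o) lf.
pose F : {linear V -> R^o} := HB.pack (f : V -> R^o) lF.
have /(bounded_funP F)/(_ 1)[M FM] : bounded_near F (nbhs (0 : V)).
  by apply/linear_bounded_continuous.
by exists M => _ [x /= x1 <-]; exact: FM.
Qed.

Let le_dual_norm (f : dual) (x : V) : `|x| <= 1 -> `|f x| <= dual_norm f.
Proof. by move=> x1; apply: sup_upper_bound => //; exists x. Qed.

Let dual_norm_le (f : dual) (M : R) :
  (forall x, `|x| <= 1 -> `|f x| <= M) -> dual_norm f <= M.
Proof.
move=> fM; apply: ge_sup; first by have [] := has_supB f.
by move=> _ [x /= x1 <-]; exact: fM.
Qed.

Let dual_norm_ge0 (f : dual) : 0 <= dual_norm f.
Proof. by apply: (le_trans _ (@le_dual_norm f 0 _)); rewrite ?normr0. Qed.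

Lemma dual_normD (f g : dual) : dual_norm (f + g) <= dual_norm f + dual_norm g.
Proof.
apply: dual_norm_le => x x1; rewrite (le_trans (ler_normD (f x) (g x)))//.
by rewrite lerD// le_dual_norm.
Qed.

Let dual_normZ_le (a : R) (f : dual) : dual_norm (a *: f) <= `|a| * dual_norm f.
Proof.
apply: dual_norm_le => x x1; rewrite [X in `|X|]/(a * f x) normrM.
by rewrite ler_wpM2l// le_dual_norm.
Qed.

Lemma dual_normZ (a : R) (f : dual) : dual_norm (a *: f) = `|a| * dual_norm f.
Proof.
apply/eqP; rewrite eq_le dual_normZ_le/=.
have [->|a0] := eqVneq a 0; first by rewrite normr0 mul0r.
rewrite -ler_pdivlMl ?normr_gt0// -normfV.
by rewrite (le_trans _ (dual_normZ_le _ _))// scalerA mulVf// scale1r.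
Qed.

Lemma dual_norm0_eq0 (f : dual) : dual_norm f = 0 -> f = 0.
Proof.
move=> f0; apply: val_inj; apply/funext => x /=.
have /set_mem[lf _] := dual_funP f.
have f00 : f 0 = 0.
  by have := lf (-1) 0 0; rewrite scaleN1r oppr0 addr0 scaleN1r addNr.
have [->//|x0] := eqVneq x 0.
have nx0 : `|x| != 0 by rewrite normr_eq0.
have : `|f (`|x|^-1 *: x)| <= 0.
  by rewrite -f0 le_dual_norm// normrZ normfV normr_id mulVf.
have := lf `|x|^-1 x 0; rewrite addr0 f00 addr0 => ->.
rewrite normr_le0 scaler_eq0 invr_eq0 (negbTE nx0)/= => /eqP ->.
by [].
Qed.

HB.instance Definition _ :=
  Lmodule_isNormed.Build R dual dual_normD dual_normZ dual_norm0_eq0.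

End Dual.

Section Ssd.
Context {R : realType} {B : completeNormedModType R}.
Implicit Types (form : {biscalar B}) (A : set B) (E : {nonneg R} -> set B).

Definition is_ssd form : Prop :=
  (exists b : B, b != 0) /\ (forall b c, form b c = form c b).

Definition ssd_q form (b : B) : R := 2^-1 * form b b.

Definition is_banach_ssd form : Prop :=
  [/\ is_ssd form,
      forall b, 0 <= 2^-1 * `|b| ^+ 2 + ssd_q form b
    & exists2 iota : {linear B -> dual B},
        continuous iota & forall b c, iota c b = form b c].

Definition qpositive form A : Prop :=
  A !=set0 /\ forall b c, A b -> A c -> 0 <= ssd_q form (b - c).

Definition maximally_qpositive form A : Prop :=
  qpositive form A /\ forall A', qpositive form A' -> A `<=` A' -> A' = A.

(* The graph is viewed inside R * B rather than {nonneg R} * B; since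
   [0, +oo[ is closed in R, both ambient spaces yield the same closures. *)
Definition graph E : set (R * B) :=
  [set p | exists2 e : {nonneg R}, e%:num = p.1 & E e p.2].

Definition mclosure E : {nonneg R} -> set B :=
  fun e => [set b | closure (graph E) (e%:num, b)].

Definition mclosed E : Prop := E = mclosure E.

Definition enlargement A E : Prop := forall e, A `<=` E e.

Definition nondecreasing_multifun E : Prop :=
  forall e1 e2 : {nonneg R}, e1%:num <= e2%:num -> E e1 `<=` E e2.

(* The witness e expresses both that the right-hand side is nonnegative and
   that the convex combination belongs to the corresponding value of E. *)
Definition transportation form E : Prop :=
  forall (e1 e2 : {nonneg R}) (b1 b2 : B) (a1 a2 : R),
    E e1 b1 -> E e2 b2 -> 0 <= a1 -> 0 <= a2 -> a1 + a2 = 1 ->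
    exists2 e : {nonneg R},
      e%:num = a1 * e1%:num + a2 * e2%:num + a1 * a2 * ssd_q form (b1 - b2)
      & E e (a1 *: b1 + a2 *: b2).

Definition enlargements form A : set ({nonneg R} -> set B) :=
  [set E | [/\ enlargement A E, nondecreasing_multifun E
             & transportation form E]].

Definition closed_enlargements form A : set ({nonneg R} -> set B) :=
  enlargements form A `&` [set E | mclosed E].

Definition max_enlargement form A : {nonneg R} -> set B :=
  fun e => [set b | forall c, A c -> - e%:num <= ssd_q form (b - c)].

Definition min_enlargement form A : {nonneg R} -> set B :=
  fun e => \bigcap_(E in enlargements form A) E e.

End Ssd.

(* Main.v *)
Require Import Defs.
From HB Require Import structures.
From mathcomp Require Import all_boot all_order all_algebra.
From mathcomp Require Import all_classical all_reals all_analysis.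
From mathcomp Require Import ring lra.
Import Order.TTheory GRing.Theory Num.Theory.
Import numFieldNormedType.Exports.

Set Implicit Arguments.
Unset Strict Implicit.
Unset Printing Implicit Defensive.

Local Open Scope classical_set_scope.
Local Open Scope ring_scope.

(** The three parts of the definition of an enlargement say that its graph
[G], a subset of [R * B], contains [[0, +oo[ * A] and is stable under certain
maps: the upward translations [(t, b) |-> (t + d, b)], and the transport maps
sending [((t1, b1), (t2, b2))] to
[(a1 t1 + a2 t2 + a1 a2 q (b1 - b2), a1 b1 + a2 b2)]. In a Banach SSD space
the form is dominated by the norm of [iota], so [q] is continuous
([continuous_ssd_q]) and all these maps are continuous; hence the closure of
[G] is stable under them too. As [G] lies in the closed half-space [0 <= t],
so does its closure, which is therefore again a graph ([graph_mclosure]).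
This gives (i) ([mclosure_enlargement]); (ii) holds because the values of
[E] are slices of its graph.

The smallest closed enlargement comes from (i) applied to [E_A], which is an
enlargement because the conditions are preserved by intersections; the family
intersected must be nonempty for the nonnegativity in the transportation
formula, and [E^A] belongs to it.

For [E^A], the identity
[q (a1 x + a2 y) = a1 q x + a2 q y - a1 a2 q (x - y)] ([ssd_q_convex]) yields
the lower bound required by the transportation formula. The nonnegativity of
the new parameter is where maximality enters: if [q (b - c)] were bounded below
by a positive constant for [c] in [A], then [A] together with [b] would be
[q]-positive, so [b] would be in [A] and [q (b - b) = 0] would be positive
([maximally_qpositive_bound]). Conversely, if [b] is in [E e] and [c] is in
[A], hence in [E 0], the transportation formula for [b] and [c] gives
[0 <= a1 e + a1 a2 q (b - c)]; dividing by [a1] and letting [a1] tend to [0]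
gives [- e <= q (b - c)], so [E^A] is the biggest enlargement
([enlargement_le_max]). *)

(** * Continuity of the quadratic form *)

Section DualBound.
Context {R : realType} {V : normedModType R}.

(** Continuity of [f] bounds it on the unit ball, which makes the supremum in
[dual_norm] a genuine one; homogeneity does the rest. *)
Lemma le_dual_norm (f : dual V) (x : V) : `|f x| <= dual_norm f * `|x|.
Proof.
have /set_mem[lf cf] := dual_funP f.
pose lF := GRing.isLinear.Build _ _ _ _ (f : V -> R^o) lf.
pose F : {linear V -> R^o} := HB.pack (f : V -> R^o) lF.
have /(bounded_funP F)/(_ 1)[M FM] : bounded_near F (nbhs (0 : V)).
  by apply/linear_bounded_continuous.
have unit_bound y : `|y| <= 1 -> `|F y| <= dual_norm f.
  move=> y1; apply: ub_le_sup; last by exists y.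
  by exists M => _ [z /= z1 <-]; exact: FM.
have [->|x0] := eqVneq x 0.
  by have -> : f 0 = 0 := linear0 F; rewrite !normr0 mulr0.
have nx0 : 0 < `|x| by rewrite normr_gt0.
rewrite -ler_pdivrMr// mulrC.
have := unit_bound (`|x|^-1 *: x).
have -> : F (`|x|^-1 *: x) = `|x|^-1 * f x := linearZ _ _.
by rewrite normrZ normrM normfV normr_id mulVf ?gt_eqF//; apply.
Qed.

End DualBound.

Section Quadratic.
Context {R : realType} {B : completeNormedModType R}.
Variable form : {biscalar B}.
Hypothesis hB : is_banach_ssd form.
Local Notation q := (ssd_q form).

Let formC b c : form b c = form c b.
Proof. by case: hB => -[_]. Qed.

Lemma form_bounded : exists k : R, forall b c, `|form b c| <= k * `|b| * `|c|.
Proof.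
have [_ _ [iota ciota iotaE]] := hB.
have /linear_boundedP : bounded_near iota (nbhs 0).
  by apply/linear_bounded_continuous.
move=> [k [_ /(_ (k + 1))]]; rewrite ltrDl ltr01 => /(_ isT) ik.
exists (k + 1) => b c; rewrite formC -iotaE.
apply: (le_trans (le_dual_norm _ _)).
by rewrite ler_wpM2r//; exact: ik.
Qed.

(** By symmetry [q c - q b] is half the value of the form at [c - b] and
[c + b], which boundedness of the form makes small. *)
Lemma continuous_ssd_q : continuous q.
Proof.
have [k formk] := form_bounded => b.
have qB c : q c - q b = 2^-1 * form (c - b) (c + b).
  rewrite /ssd_q linearBl/= !linearDr/= (formC b c); ring.
apply/subr_cvg0/norm_cvg0P.
apply: (@squeeze_cvgr _ _ _ _ (cst 0)
  (fun c => 2^-1 * (k * `|c - b| * `|c + b|))).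
- by near=> c; rewrite normr_ge0 qB normrM ger0_norm// ler_wpM2l.
- exact: cvg_cst.
- have nB : `|c - b| @[c --> b] --> (0 : R).
    rewrite -(normr0 B) -(subrr b); apply: cvg_norm.
    by apply: cvgB; [exact: cvg_id|exact: cvg_cst].
  have -> : 0 = 2^-1 * (k * 0 * `|b + b|) :> R by ring.
  apply: cvgM; first exact: cvg_cst.
  apply: cvgM; first by apply: cvgM => //; exact: cvg_cst.
  by apply: cvg_norm; apply: cvgD; [exact: cvg_id|exact: cvg_cst].
Unshelve. all: by end_near. Qed.

Lemma ssd_q0 : q 0 = 0.
Proof. by rewrite /ssd_q linear0r mulr0. Qed.

Lemma ssd_qN b : q (- b) = q b.
Proof. by rewrite /ssd_q linearNr linearNl/= opprK. Qed.

Lemma ssd_q_convex (a1 a2 : R) x y : a1 + a2 = 1 ->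
  q (a1 *: x + a2 *: y) = a1 * q x + a2 * q y - a1 * a2 * q (x - y).
Proof.
move=> a12; have -> : a2 = 1 - a1 by rewrite -a12; ring.
have -> : q (x - y) = 2^-1 * (form x x - 2 * form x y + form y y).
  by rewrite /ssd_q linearBl/= !linearBr/= (formC y x); ring.
have formZD u : form (a1 *: x + (1 - a1) *: y) u
    = a1 * form x u + (1 - a1) * form y u by rewrite linearDl/= !linearZl.
rewrite /ssd_q formZD !linearDr/= !linearZr/= (formC y x) /GRing.scale/=; ring.
Qed.

End Quadratic.

(** * Closures of graphs *)

Section Closure.
Context {T U : topologicalType}.

Lemma closure_image_sub (f : T -> U) (A : set T) (C : set U) :
  continuous f -> (forall x, A x -> C (f x)) ->
  forall x, closure A x -> closure C (f x).
Proof.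
move=> cf fAC x Ax.
have /continuous_closedP/(_ _ (@closed_closure _ C)) := cf; apply.
by apply: closureS Ax => y Ay /=; apply: subset_closure; exact: fAC.
Qed.

End Closure.

Lemma continuous_pair {T U V : topologicalType} (f : T -> U) (g : T -> V) :
  continuous f -> continuous g -> continuous (fun x => (f x, g x)).
Proof.
move=> cf cg x; apply: (@cvg_pair _ _ _ _ (nbhs (f x)) (nbhs (g x))).
- exact: cf.
- exact: cg.
Qed.

Section Graphs.
Context {R : realType} {B : completeNormedModType R}.
Implicit Types (E : {nonneg R} -> set B) (A : set B).

Lemma graphE E (e : {nonneg R}) b : graph E (e%:num, b) <-> E e b.
Proof.
split=> [[e' /= ee' E'b]|Eb]; last by exists e.
by rewrite -(_ : e' = e)//; apply/val_inj.
Qed.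

Lemma graph_ge0 E p : closure (graph E) p -> 0 <= p.1.
Proof.
move=> Gp; have /closure_id cge := @closed_ge R 0.
suff : closure [set x : R | 0 <= x] p.1 by rewrite -cge.
apply: closure_image_sub Gp; last by move=> [_ b] [e /= <- _].
by move=> x; exact: cvg_fst.
Qed.

Lemma graph_mclosure E : graph (mclosure E) = closure (graph E).
Proof.
apply/seteqP; split=> [[t b] [e /= <-]//|[t b] Gtb].
by have t0 := graph_ge0 Gtb; exists (NngNum t0).
Qed.

Lemma mclosed_mclosure E : mclosed (mclosure E).
Proof.
apply/funext => e; apply/seteqP; split=> b; rewrite /mclosure/= graph_mclosure;
  by have /closure_id <- := @closed_closure _ (graph E).
Qed.

Lemma graph_mclosed E : mclosed E -> closed (graph E).
Proof. by move=> ->; rewrite graph_mclosure; exact: closed_closure. Qed.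

Lemma mclosed_closed E (e : {nonneg R}) : mclosed E -> closed (E e).
Proof.
move=> /graph_mclosed Gc.
have -> : E e = (fun b => (e%:num, b)) @^-1` graph E.
  by apply/seteqP; split=> b /graphE.
have /continuous_closedP : continuous (fun b : B => (e%:num, b)).
  by apply: continuous_pair => b; [exact: cvg_cst|exact: cvg_id].
exact.
Qed.

End Graphs.

(** * Closure of an enlargement *)

Section Enlargements.
Context {R : realType} {B : completeNormedModType R}.
Variables (form : {biscalar B}) (A : set B).
Hypothesis hB : is_banach_ssd form.
Local Notation q := (ssd_q form).
Implicit Types E : {nonneg R} -> set B.

Definition transport (a1 a2 : R) (p1 p2 : R * B) : R * B :=
  (a1 * p1.1 + a2 * p2.1 + a1 * a2 * q (p1.2 - p2.2),
   a1 *: p1.2 + a2 *: p2.2).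

Lemma transportationP E : transportation form E <->
  forall a1 a2 : R, 0 <= a1 -> 0 <= a2 -> a1 + a2 = 1 -> forall p1 p2,
    graph E p1 -> graph E p2 -> graph E (transport a1 a2 p1 p2).
Proof.
split=> [tE a1 a2 a10 a20 a12 [_ b1] [_ b2] [e1 /= <- E1] [e2 /= <- E2]|].
  by have [e eE Ee] := tE _ _ _ _ _ _ E1 E2 a10 a20 a12; exists e.
move=> tG e1 e2 b1 b2 a1 a2 /graphE E1 /graphE E2 a10 a20 a12.
exact: tG E1 E2.
Qed.

(** Separate continuity suffices below: it is applied to one argument at a
time. *)
Lemma continuous_transportl a1 a2 p2 :
  continuous (fun p1 => transport a1 a2 p1 p2).
Proof.
apply: continuous_pair => p1.
  have c1 : p.1 @[p --> p1] --> p1.1 by exact: cvg_fst.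
  have c2 : p.2 @[p --> p1] --> p1.2 by exact: cvg_snd.
  apply: cvgD.
    apply: cvgD; last exact: cvg_cst.
    by apply: cvgM => //; exact: cvg_cst.
  apply: cvgM; first exact: cvg_cst.
  apply: continuous_cvg; first exact: continuous_ssd_q.
  by apply: cvgB => //; exact: cvg_cst.
apply: cvgD; last exact: cvg_cst.
by apply: cvgZ; [exact: cvg_cst|exact: cvg_snd].
Qed.

Lemma transportC a1 a2 p1 p2 : transport a1 a2 p1 p2 = transport a2 a1 p2 p1.
Proof.
rewrite /transport -opprB ssd_qN [a2 *: _ + _]addrC.
by congr (_ , _); ring.
Qed.

Lemma continuous_transportr a1 a2 p1 : continuous (transport a1 a2 p1).
Proof.
have -> : transport a1 a2 p1 = fun p2 => transport a2 a1 p2 p1.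
  by apply/funext => p2; exact: transportC.
exact: continuous_transportl.
Qed.

(** The graph of [E] is stable under upward translations and under transport,
both continuous, so its closure is stable as well. *)
Lemma mclosure_enlargement E :
  enlargements form A E -> closed_enlargements form A (mclosure E).
Proof.
move=> [AE nE /transportationP tE]; split; last exact: mclosed_mclosure.
split.
- by move=> e b /(AE e)/graphE; exact: subset_closure.
- move=> e1 e2 e12 b E1.
  pose shift (p : R * B) := (p.1 + (e2%:num - e1%:num), p.2).
  have -> : mclosure E e2 b = closure (graph E) (shift (e1%:num, b)).
    by rewrite /shift/= addrC subrK.
  apply: closure_image_sub E1.
    apply: continuous_pair => p; last exact: cvg_snd.
    by apply: cvgD; [exact: cvg_fst|exact: cvg_cst].
  move=> [_ c] [e /= <- Ec].
  have d0 : 0 <= e%:num + (e2%:num - e1%:num) by rewrite addr_ge0 ?subr_ge0.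
  by exists (NngNum d0) => //=; apply: nE Ec; rewrite /= lerDl subr_ge0.
- apply/transportationP; rewrite graph_mclosure => a1 a2 a10 a20 a12 p1 p2 G1 G2.
  have /closure_id -> := @closed_closure _ (graph E).
  apply: (closure_image_sub (@continuous_transportl a1 a2 p2)) G1 => {}p1 G1.
  apply: (closure_image_sub (@continuous_transportr a1 a2 p1)) G2 => {}p2 G2.
  exact: tE.
Qed.

(** * The biggest and the smallest enlargement *)

Lemma enlargement_le_max E e :
  enlargements form A E -> E e `<=` max_enlargement form A e.
Proof.
move=> [AE _ tE] b Eb c Ac; rewrite leNgt; apply/negP => qlt.
have q0 : q (b - c) < 0 by apply: lt_le_trans qlt _; rewrite oppr_le0.
(* Any a2 in ]0, 1[ with a2 * q (b - c) < - e contradicts the transportation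
   formula; this one makes a2 * q (b - c) the midpoint of q (b - c) and - e. *)
pose a2 := (q (b - c) - e%:num) / 2 / q (b - c).
have a2q : a2 * q (b - c) = (q (b - c) - e%:num) / 2.
  by rewrite /a2 divfK// lt_eqF.
have e0 : 0 <= e%:num by [].
have a20 : 0 <= a2 by rewrite -(ler_nM2r q0) a2q mul0r; lra.
have a21 : 0 < 1 - a2 by rewrite subr_gt0 -(ltr_nM2r q0) a2q mul1r; lra.
have := tE e 0%:nng b c (1 - a2) a2 Eb (AE _ _ Ac) (ltW a21) a20 (subrK _ _).
move=> [e' e'E _]; have : 0 <= e'%:num by [].
rewrite e'E /= mulr0 addr0 -mulrA -mulrDr a2q pmulr_rge0//; lra.
Qed.

Hypothesis hA : maximally_qpositive form A.

(** A positive lower bound [t] would make the union of [A] and [b]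
[q]-positive, forcing [b] into [A], where [c := b] gives [t <= q 0 = 0]. *)
Lemma maximally_qpositive_bound b t :
  (forall c, A c -> t <= q (b - c)) -> t <= 0.
Proof.
have [[A0 Apos] Amax] := hA.
move=> tle; rewrite leNgt; apply/negP => t0.
have qb c : A c -> 0 <= q (b - c) by move=> /tle; apply/le_trans/ltW.
have Ab : (A `|` [set b]) b by right.
have AE : A `|` [set b] = A; last first.
  by rewrite AE in Ab; have := tle b Ab; rewrite subrr ssd_q0 leNgt t0.
apply: Amax; last by left.
split; first by have [c Ac] := A0; exists c; left.
move=> x y [Ax|->] [Ay|->].
- exact: Apos.
- by rewrite -opprB ssd_qN; exact: qb.
- exact: qb.
- by rewrite subrr ssd_q0.
Qed.

Lemma max_enlargement_enlargement :
  enlargements form A (max_enlargement form A).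
Proof.
have [[_ Apos] _] := hA; split.
- by move=> e b Ab c Ac; apply: le_trans (Apos _ _ Ab Ac); rewrite oppr_le0.
- by move=> e1 e2 e12 b E1 c /E1; apply: le_trans; rewrite lerN2.
- move=> e1 e2 b1 b2 a1 a2 E1 E2 a10 a20 a12.
  pose t := a1 * e1%:num + a2 * e2%:num + a1 * a2 * q (b1 - b2).
  have qt c : A c -> - t <= q (a1 *: b1 + a2 *: b2 - c).
    move=> Ac.
    have -> : a1 *: b1 + a2 *: b2 - c = a1 *: (b1 - c) + a2 *: (b2 - c).
      by rewrite !scalerBr addrACA -opprD -scalerDl a12 scale1r.
    rewrite ssd_q_convex//.
    have -> : b1 - c - (b2 - c) = b1 - b2 by rewrite opprB addrA subrK.
    have := ler_wpM2l a10 (E1 _ Ac); have := ler_wpM2l a20 (E2 _ Ac).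
    rewrite /t; lra.
  have t0 : 0 <= t by rewrite -oppr_le0; exact: maximally_qpositive_bound qt.
  by exists (NngNum t0).
Qed.

Lemma mclosed_max_enlargement : mclosed (max_enlargement form A).
Proof.
apply/funext => e; apply/seteqP; split=> [b /graphE|]; first exact: subset_closure.
(* The closure is an enlargement, so it lies below the biggest one. *)
have [clE _] := mclosure_enlargement max_enlargement_enlargement.
exact: enlargement_le_max clE.
Qed.

(** The parameter produced by the transportation formula does not depend on the
enlargement, so a single one serves for the whole intersection; its
nonnegativity is read off the enlargement [max_enlargement form A]. *)
Lemma min_enlargement_enlargement :
  enlargements form A (min_enlargement form A).
Proof.
split.
- by move=> e b Ab E [AE _ _]; exact: AE.
- by move=> e1 e2 e12 b mb E EA; have [_ nE _] := EA; apply: nE e12 _ (mb E EA).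
- move=> e1 e2 b1 b2 a1 a2 m1 m2 a10 a20 a12.
  have tr E (EA : enlargements form A E) :=
    let: And3 _ _ tE := EA in tE _ _ _ _ _ _ (m1 E EA) (m2 E EA) a10 a20 a12.
  have [e eE _] := tr _ max_enlargement_enlargement.
  exists e => // E EA; have [e' e'E Ee'] := tr E EA.
  by rewrite (_ : e = e')//; apply/val_inj; rewrite /= eE e'E.
Qed.

End Enlargements.

Theorem proposition8 (R : realType) (B : completeNormedModType R)
    (form : {biscalar B}) (A : set B)
    (hB : is_banach_ssd form) (hA : maximally_qpositive form A) :
  [/\ (* (i) *)
      forall E : {nonneg R} -> set B,
        enlargements form A E -> closed_enlargements form A (mclosure E),
      (* (ii) *)
      forall E : {nonneg R} -> set B,
        closed_enlargements form A E -> forall e, closed (E e)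
    & (* (iii) *)
      [/\ closed_enlargements form A (mclosure (min_enlargement form A)),
          closed_enlargements form A (max_enlargement form A)
        & forall E : {nonneg R} -> set B, closed_enlargements form A E ->
            graph (mclosure (min_enlargement form A)) `<=` graph E /\
            graph E `<=` graph (max_enlargement form A)]].
Proof.
split=> [E|E [_ Ec] e|].
- exact: mclosure_enlargement.
- exact: mclosed_closed.
split.
- exact/(mclosure_enlargement hB)/min_enlargement_enlargement.
- by split; [exact: max_enlargement_enlargement|exact: mclosed_max_enlargement].
move=> E [EA Ec]; split.
- have /graph_mclosed/closure_id -> := Ec.
  rewrite graph_mclosure; apply: closureS => -[_ b] [e /= <- mb].
  by exists e => //; exact: mb.
- by move=> [_ b] [e /= <- Eb]; exists e => //; exact: enlargement_le_max Eb.
Qed.
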